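(* Let $a_1,a_2$ be positive integers and let $\lambda=((a_1+a_2)^{a_1},a_1^{a_2})$ (a fat hook). Then, for every integer $k\ge 1$, the number $C_k^{\lambda}$ of $\lambda$-plane trees on $k+1$ vertices is $$C_k^{\lambda}=C_k\,a_1^{k+1}\;{}_2F_1\!\left(-k-1,\,-k;\;k;\;\frac{a_2}{a_1}\right),$$ where $C_k=\frac{1}{k+1}\binom{2k}{k}$ is the $k$-th Catalan number and ${}_2F_1$ is the hypergeometric function.
   Context: The hypergeometric function is ${}_2F_1(\alpha,\beta;\gamma;x)=\sum_{j=0}^\infty\frac{(\alpha)_j(\beta)_j}{(\gamma)_j}\frac{x^j}{j!}$, with $(\alpha)_j=\alpha(\alpha+1)\cdots(\alpha+j-1)$, $(\alpha)_0=1$. A partition is a weakly decreasing sequence $\lambda=(\lambda_1\ge\lambda_2\ge\cdots)$ of nonnegative integers, eventually zero; its length $\ell(\lambda)$ is the number of positive parts. The notation $((a_1+a_2)^{a_1},a_1^{a_2})$ denotes the partition with $a_1$ parts equal to $a_1+a_2$ followed by $a_2$ parts equal to $a_1$. A partition is identified with its Young diagram $\{(i,j)\in\mathbb{Z}^2:1\le i\le\ell(\lambda),\ 1\le j\le\lambda_i\}$ (the fat hook is self-conjugate, i.e. its diagram is invariant under $(i,j)\mapsto(j,i)$). A plane tree is a rooted tree in which the children of every vertex are linearly ordered. For $\lambda$ self-conjugate of length $\ell$, a $\lambda$-plane tree is a pair $(T,c)$, where $T$ is a plane tree with vertex set $V$ and edge set $E$ and $c:V\to\{1,\dots,\ell\}$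 satisfies $(c(u),c(v))\in\lambda$ whenever $\{u,v\}\in E$. They are counted up to isomorphism preserving root, order of children, and labels. *)

(* Defs.v *)
From HB Require Import structures.
From mathcomp Require Import all_boot all_order all_algebra.
From mathcomp Require Import all_classical all_reals all_analysis.
From mathcomp Require Import zify.

Set Implicit Arguments.
Unset Strict Implicit.
Unset Printing Implicit Defensive.

Import Order.TTheory GRing.Theory Num.Theory.
Import numFieldNormedType.Exports.

Local Open Scope nat_scope.

(** * Partitions *)

Definition is_partition (la : seq nat) : bool := sorted geq la.

(* Trailing zero parts are allowed, so this is not [size la] in general. *)
Definition part_length (la : seq nat) : nat := count (leq 1) la.

(* Rows and columns are numbered from 1, while [nth] counts from 0. *)
Definition diagram (la : seq nat) : pred (nat * nat) :=
  [pred p | (1 <= p.1 <= part_length la) && (1 <= p.2 <= nth 0 la p.1.-1)].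

Definition self_conjugate (la : seq nat) : Prop :=
  forall i j, ((i, j) \in diagram la) = ((j, i) \in diagram la).

Definition fat_hook (a1 a2 : nat) : seq nat :=
  nseq a1 (a1 + a2) ++ nseq a2 a1.

Lemma fat_hook_partition a1 a2 : is_partition (fat_hook a1 a2).
Proof.
have tr : transitive geq by move=> y x z /= yx zy; exact: leq_trans zy yx.
rewrite /is_partition /fat_hook (sorted_pairwise tr) pairwise_cat.
apply/and3P; split; first 1 last.
- by elim: a1 (a1 + a2) => //= n IH m; rewrite IH all_nseq /= leqnn orbT.
- by elim: a2 => //= n ->; rewrite all_nseq /= leqnn orbT.
apply/allrelP => x y /nseqP[-> _] /nseqP[-> _] /=; exact: leq_addr.
Qed.

Lemma fat_hook_length a1 a2 : 0 < a1 -> part_length (fat_hook a1 a2) = a1 + a2.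
Proof.
move=> a1_gt0; rewrite /part_length /fat_hook count_cat !count_nseq a1_gt0.
by rewrite ltn_addr // !mul1n.
Qed.

Lemma fat_hook_self_conjugate a1 a2 :
  0 < a1 -> self_conjugate (fat_hook a1 a2).
Proof.
move=> a1_gt0 i j; rewrite !inE /= fat_hook_length // /fat_hook.
rewrite !nth_cat !size_nseq !nth_nseq.
by do !case: ifP; lia.
Qed.

(** * Labelled plane trees *)

(* A plane tree [T] together with a labelling [V -> L] of its vertices, up to
   isomorphism: a vertex is given by its label and the list of the subtrees
   rooted at its children, in order.  Plane trees have no nontrivial
   automorphism, so distinct terms are non-isomorphic. *)
Inductive ltree (L : Type) : Type := Node of L & seq (ltree L).

Definition root_label (L : Type) (t : ltree L) : L := let: Node x _ := t in x.

Fixpoint num_vertices (L : Type) (t : ltree L) : nat :=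
  let: Node _ ts := t in (sumn [seq num_vertices u | u <- ts]).+1.

(* [edgewise e t]: every edge of [t] has labels related by [e], the label of
   the parent coming first. *)
Fixpoint edgewise (L : Type) (e : rel L) (t : ltree L) : bool :=
  let: Node x ts := t in
  all (fun u => e x (root_label u) && edgewise e u) ts.

Section LTreeChoice.
Variable L : Type.

Fixpoint ltree_encode (t : ltree L) : GenTree.tree L :=
  let: Node x ts := t in
  GenTree.Node 0 (GenTree.Leaf x :: [seq ltree_encode u | u <- ts]).

Fixpoint ltree_decode (g : GenTree.tree L) : option (ltree L) :=
  if g is GenTree.Node _ (GenTree.Leaf x :: gs)
  then Some (Node x (pmap ltree_decode gs)) else None.

Lemma ltree_encodeK : pcancel ltree_encode ltree_decode.
Proof.
rewrite /pcancel; fix IH 1 => -[x ts] /=; congr (Some (Node x _)).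
by elim: ts => //= u ts IHts; rewrite IH /= IHts.
Qed.
End LTreeChoice.

HB.instance Definition _ (L : eqType) :=
  Equality.copy (ltree L) (pcan_type (@ltree_encodeK L)).
HB.instance Definition _ (L : choiceType) :=
  Choice.copy (ltree L) (pcan_type (@ltree_encodeK L)).
HB.instance Definition _ (L : countType) :=
  Countable.copy (ltree L) (pcan_type (@ltree_encodeK L)).

(* [lforests L d] contains all forests with at most [d] vertices (and others);
   it is only used to show that there are finitely many trees of a given size. *)
Fixpoint lforests (L : finType) (d : nat) : seq (seq (ltree L)) :=
  if d isn't d'.+1 then [:: [::]] else
  [::] :: [seq Node x p.1 :: p.2 | x <- enum L,
             p <- [seq (f, g) | f <- lforests L d', g <- lforests L d']].

Lemma mem_lforests (L : finType) d (f : seq (ltree L)) :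
  sumn [seq num_vertices u | u <- f] <= d -> f \in lforests L d.
Proof.
elim: d f => [|d IH] [|[x ts] f] //=.
rewrite addSn ltnS => le_d; rewrite inE.
apply: (allpairs_f (fun x p => Node x p.1 :: p.2) _
          (y := (ts, f))); first by rewrite mem_enum.
by apply: allpairs_f; apply: IH; apply: leq_trans le_d;
  rewrite ?leq_addr ?leq_addl.
Qed.

(** * lambda-plane trees *)

(* The label [x : 'I_l] stands for the element [x + 1] of {1, ..., l}.  The
   relation is symmetric when [la] is self-conjugate, so that it does not matter
   which end of an edge is its parent. *)
Definition diagram_rel (la : seq nat) : rel 'I_(part_length la) :=
  fun x y => (x.+1, y.+1) \in diagram la.

Definition is_lambda_tree (la : seq nat) (n : nat) :
    pred (ltree 'I_(part_length la)) :=
  fun t => edgewise (@diagram_rel la) t && (num_vertices t == n).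

(* The [la]-plane trees on [n] vertices. *)
Record lambda_tree (la : seq nat) (n : nat) : Type := LambdaTree {
  lambda_tree_val :> ltree 'I_(part_length la);
  _ : is_lambda_tree n lambda_tree_val }.

HB.instance Definition _ la n := [isSub for @lambda_tree_val la n].
HB.instance Definition _ la n := [Countable of lambda_tree la n by <:].

Definition lambda_tree_enum la n : seq (lambda_tree la n) :=
  undup (pmap (fun f => obind insub (ohead f)) (lforests 'I_(part_length la) n)).

Lemma lambda_tree_enumP la n : Finite.axiom (lambda_tree_enum la n).
Proof.
apply: Finite.uniq_enumP (undup_uniq _) _ => t.
rewrite mem_undup mem_pmap; apply/mapP; exists [:: val t] => /=.
  case: (t) => s sP /=; have /andP[_ /eqP tn] := sP.
  by apply: mem_lforests; rewrite /= addn0 tn.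
by rewrite /= valK.
Qed.

HB.instance Definition _ la n :=
  fintype.isFinite.Build (lambda_tree la n) (@lambda_tree_enumP la n).

Definition num_lambda_trees (la : seq nat) (n : nat) : nat :=
  #|{: lambda_tree la n}|.

(** * Catalan numbers and the hypergeometric function *)

Local Open Scope ring_scope.

Definition catalan (R : realType) (k : nat) : R :=
  k.+1%:R^-1 * 'C(2 * k, k)%:R.

Definition pochhammer (R : realType) (a : R) (j : nat) : R :=
  \prod_(i < j) (a + i%:R).

Definition hypergeometric_term (R : realType) (a b c x : R) (j : nat) : R :=
  pochhammer a j * pochhammer b j / pochhammer c j * (x ^+ j / j`!%:R).

(* Meaningful when the series converges, e.g. when it terminates because [a] or
   [b] is a nonpositive integer. *)
Definition hyp2F1 (R : realType) (a b c x : R) : R :=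
  limn (series (hypergeometric_term a b c x)).

(* Main.v *)
Require Import Defs.
From HB Require Import structures.
From mathcomp Require Import all_boot all_order all_algebra.
From mathcomp Require Import all_classical all_reals all_analysis.
From mathcomp Require Import zify ring.

Set Implicit Arguments.
Unset Strict Implicit.
Unset Printing Implicit Defensive.

Import Order.TTheory GRing.Theory Num.Theory.
Import numFieldNormedType.Exports.

Local Open Scope ring_scope.

(** The labels split into a class [A] of size p = a1 and its complement of size q = a2, and two
    labels may be adjacent exactly when at least one lies in [A]. Trees are counted through ordered
    forests with prescribed root labels and n non-root vertices.

    The resulting recurrence ([size_rooted_forestsS]) sees only the numbers d and e of roots inside
    and outside [A]. The polynomial [forest_form] in p and q solves it ([size_rooted_forests]), by
    Pascal's rule and one binomial ratio ([forest_coef_stepA], [forest_coef_stepB]). Summing over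
    one-root forests gives the coefficient [tree_coef k j] of p^(k+1-j) q^j
    ([sum_size_rooted_forests]). These coefficients start at C_k and have the term ratio of the
    hypergeometric series ([catalan_hyp2F1]); pulling p^(k+1) out leaves powers of a2/a1. *)

(** * Enumeration of forests by cutting the first edge *)

Section Graft.
Local Open Scope nat_scope.
Variables (L : finType) (e : rel L).

Definition graft (ts : seq (ltree L)) : seq (ltree L) :=
  if ts is u :: Node y us :: ts' then Node y (u :: us) :: ts' else ts.

Definition ungraft (ts : seq (ltree L)) : seq (ltree L) :=
  if ts is Node y (u :: us) :: ts' then u :: Node y us :: ts' else ts.

(** [n] counts only the non-root vertices, the quantity that drops by one when an edge is cut. *)
Definition rooted_forest (n : nat) (s : seq L) : pred (seq (ltree L)) :=
  fun ts => [&& map (@root_label L) ts == s, all (edgewise e) ts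
    & sumn (map (@num_vertices L) ts) == n + size s].

(** The inner [fix] drops a leaf root at constant [n]; the other branch lowers [n] but lengthens the
    list of roots, whence the nested recursion. *)
Fixpoint rooted_forests (n : nat) : seq L -> seq (seq (ltree L)) :=
  if n isn't n'.+1 then fun s => [:: [seq Node x [::] | x <- s]] else
  fix forests_n s := if s isn't y :: s' then [::] else
    [seq Node y [::] :: ts | ts <- forests_n s'] ++
    [seq graft ts | ts <- flatten [seq rooted_forests n' (x :: y :: s')
                                  | x <- enum L & e y x]].

Lemma size_vertices (ts : seq (ltree L)) :
  size ts <= sumn (map (@num_vertices L) ts).
Proof. by elim: ts => //= -[x us] ts /=; lia. Qed.

Lemma mem_rooted_forests n s ts :
  (ts \in rooted_forests n s) = rooted_forest n s ts.
Proof.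
elim: n s ts => [|n IHn] s.
  rewrite /rooted_forest; elim: s => [|y s IHs] [|[x us] ts] //=.
  rewrite inE; apply/eqP/idP.
    case=> -> -> ->; have := IHs [seq Node x [::] | x <- s].
    by rewrite inE eqxx eqseq_cons eqxx /= => /esym/and3P[-> -> /eqP->]; lia.
  rewrite eqseq_cons => /and3P[/andP[/eqP<- /eqP sE] /andP[_ h] h'].
  (* Every tree has at least one vertex, so with no non-root vertex to spare the root [x] has no
     child. *)
  have := size_vertices ts; have := size_map (@root_label L) ts.
  rewrite sE => st tss; case: us h' => [|[z us'] us] /= h'; last by lia.
  have := IHs ts; rewrite sE eqxx h inE /= => /esym tsE.
  by congr (_ :: _); apply/eqP; rewrite -tsE; lia.
elim: s => [|y s IHs] ts /=.
  by rewrite in_nil; case: ts.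
rewrite mem_cat; apply/orP/idP.
  case=> /mapP[ts' + ->].
    rewrite IHs => /and3P[/eqP <- h /eqP h'].
    by rewrite /rooted_forest /= eqxx h h' /=; lia.
  case/flatten_mapP => x; rewrite mem_filter => /andP[exy _].
  rewrite IHn /rooted_forest.
  case: ts' => [|u [|[z us] ts'']] //=; rewrite ?eqseq_cons ?andbF //.
  case/and3P => /and3P[/eqP ux /eqP -> ->] /and3P[eu -> ->] /eqP.
  by rewrite eqxx ux exy eu /=; lia.
case: ts => [|[z [|u us]] ts] /and3P[] //=; rewrite eqseq_cons => /andP[/eqP -> sE].
  move=> h /eqP h'; left; apply: map_f; rewrite IHs /rooted_forest sE h /=.
  by apply/eqP; lia.
(* The first root has a first child [u]; detaching it gives the preimage under [graft]. *)
case/andP=> /andP[/andP[eyu eu] h1] h2 /eqP h3; right.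
apply/mapP; exists (u :: Node y us :: ts) => //.
apply/flatten_mapP; exists (root_label u); first by rewrite mem_filter eyu mem_enum.
rewrite IHn /rooted_forest /= !eqseq_cons !eqxx sE eu h1 h2 /=.
by apply/eqP; lia.
Qed.

(** The two branches differ in whether the first root has a child, and within the second branch
    [ungraft] recovers the forest, hence also [x]. *)
Lemma uniq_rooted_forests n s : uniq (rooted_forests n s).
Proof.
elim: n s => [|n IHn] s //=; elim: s => [|y s IHs] //=.
rewrite cat_uniq map_inj_uniq ?IHs /=; last by move=> ? ? [].
have fl x ts : ts \in rooted_forests n [:: x, y & s] ->
    exists u us ts', [/\ ts = u :: Node y us :: ts' & root_label u = x].
  rewrite mem_rooted_forests => /and3P[+ _ _].
  case: ts => [|u [|[z us] ts']] //=; rewrite ?eqseq_cons ?andbF //.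
  by case/and3P => /eqP <- /eqP -> _; exists u, us, ts'.
apply/andP; split.
  apply/hasPn => _ /mapP[ts /flatten_mapP[x _ /fl[u [us [ts' [-> _]]]] ->]] /=.
  by apply/negP => /mapP[? _] [].
(* [graft] fixes one-tree forests, so it is injective only on forests with at least two trees, which
   [fl] guarantees. *)
rewrite map_inj_in_uniq; last first.
  move=> ts1 ts2 /flatten_mapP[x1 _ /fl[u1 [us1 [ts1' [-> _]]]]].
  move=> /flatten_mapP[x2 _ /fl[u2 [us2 [ts2' [-> _]]]]].
  exact: (congr1 ungraft).
elim: (enum L) (enum_uniq L) => //= x xs IHxs /andP[xxs uxs].
case: ifP => _; last exact: IHxs.
rewrite /= cat_uniq IHn IHxs // andbT.
apply/hasPn => ts /flatten_mapP[x' x'xs /fl[u [us [ts' [-> ux']]]]].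
apply/negP => /fl[_ [_ [_ [[<- _ _] ux]]]].
by move: x'xs; rewrite mem_filter -ux' ux (negPf xxs) andbF.
Qed.

Lemma size_rooted_forestsS n y s :
  size (rooted_forests n.+1 (y :: s)) = size (rooted_forests n.+1 s)
    + \sum_(x | e y x) size (rooted_forests n (x :: y :: s)).
Proof.
rewrite /= size_cat !size_map size_flatten /shape -map_comp sumnE big_map.
by rewrite big_filter big_enum_cond.
Qed.

Definition edgewise_tree (n : nat) : pred (ltree L) :=
  fun t => edgewise e t && (num_vertices t == n).

(** A tree is a forest with a single root. Stating this for any type [T] that parametrizes the trees
    allows [e] to be replaced by a simpler form of the relation independently of [T]. *)
Lemma count_edgewise_trees (T : finType) (v : T -> ltree L) n :
  injective v -> (forall t, edgewise_tree n.+1 t = (t \in codom v)) ->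
  #|T| = \sum_x size (rooted_forests n [:: x]).
Proof.
move=> v_inj vP.
pose ts := flatten [seq rooted_forests n [:: x] | x <- enum L].
have fl x fs : fs \in rooted_forests n [:: x] ->
    exists2 t, fs = [:: t] & root_label t = x.
  rewrite mem_rooted_forests => /and3P[+ _ _].
  case: fs => [|t [|? ?]] //=; rewrite ?eqseq_cons ?andbF // andbT.
  by move=> /eqP <-; exists t.
have -> : \sum_x size (rooted_forests n [:: x]) = size ts.
  by rewrite size_flatten /shape -map_comp sumnE big_map big_enum.
rewrite cardE -(size_map (fun x => [:: v x])).
apply/perm_size/uniq_perm.
- by rewrite map_inj_uniq ?enum_uniq // => x y [/v_inj].
- rewrite /ts; elim: (enum L) (enum_uniq L) => //= x xs IHxs /andP[xxs uxs].
  rewrite cat_uniq uniq_rooted_forests IHxs // andbT.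
  apply/hasPn => fs /flatten_mapP[x' x'xs /fl[t -> tx']].
  by apply/negP => /fl[_ [<-] tx]; rewrite -tx tx' x'xs in xxs.
move=> fs; apply/mapP/flatten_mapP => [[x _ ->]|[x _ fsx]].
  exists (root_label (v x)); first by rewrite mem_enum.
  have := vP (v x); rewrite codom_f mem_rooted_forests /rooted_forest /=.
  by case/andP=> -> /eqP->; rewrite !eqxx /= addn0 addn1.
have [t fsE _] := fl _ _ fsx; move: fsx; rewrite mem_rooted_forests fsE.
case/and3P=> _ /= /[!andbT] te; rewrite addn0 addn1 => tn.
have : t \in codom v by rewrite -vP /edgewise_tree te.
by case/codomP => x' ->; exists x'; rewrite ?mem_enum.
Qed.
End Graft.

(** * Homogeneous polynomials in p and q *)

Section BinaryForm.
Variables (R : comNzRingType) (p q : R).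
Implicit Types (f g : nat -> R) (n : nat).

Definition binary_form (c : nat -> R) (n : nat) : R :=
  \sum_(j < n.+1) c j * (p ^+ (n - j) * q ^+ j).

(** Multiplying by q shifts the coefficients by one. The hypothesis on [f] removes the extra top
    term of the form of degree [n.+1]. *)
Lemma binary_form_step f g n : f n.+1 = 0 ->
  p * binary_form f n + q * binary_form g n =
  binary_form (fun j => f j + (if j is i.+1 then g i else 0)) n.+1.
Proof.
move=> f0; rewrite /binary_form !big_distrr /=.
under [RHS]eq_bigr do rewrite mulrDl.
rewrite big_split /= [X in _ = X + _]big_ord_recr /= f0 mul0r addr0; congr (_ + _).
  apply: eq_bigr => i _; rewrite subSn; last by rewrite -ltnS.
  by rewrite exprS; ring.
rewrite [RHS]big_ord_recl /= mul0r add0r; apply: eq_bigr => i _.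
by rewrite /bump /= add1n subSS exprS; ring.
Qed.
Lemma eq_binary_form f g n : (forall j, (j <= n)%N -> f j = g j) ->
  binary_form f n = binary_form g n.
Proof. by move=> fg; apply: eq_bigr => j _; rewrite fg // -ltnS. Qed.

Lemma binary_formD f g n :
  binary_form (fun j => f j + g j) n = binary_form f n + binary_form g n.
Proof. by rewrite -big_split; apply: eq_bigr => j _; rewrite mulrDl. Qed.
End BinaryForm.

(** * Closed form of the coefficients and its recurrences *)

Section ClosedForm.
Variable R : numFieldType.

(** The coefficient of p^(n-j) q^j, where j is the number of non-root vertices outside [A], for d
    roots in [A] and e roots outside. *)
Definition forest_coef (n d e j : nat) : R :=
  'C(n + d, j)%:R / (n + d)%:R *
  (d%:R * 'C((n + (n + d + e)).-1, (n + d + e + j).-1)%:R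
   + e%:R * 'C((n + (n + d + e)).-1, n + d + e + j)%:R).

(** All three terms share the factor 'C(n+d+1, j) / (n+d+1), so Pascal's rule suffices. *)
Lemma forest_coef_stepB n d e j :
  forest_coef n.+1 d e.+1 j =
  forest_coef n.+1 d e j + forest_coef n d.+1 e.+1 j.
Proof.
rewrite /forest_coef.
have -> : (n + d.+1 = n.+1 + d)%N by lia.
have -> : ((n.+1 + (n.+1 + d + e.+1)).-1 = (n + (n.+1 + d + e)).+1)%N by lia.
have -> : ((n.+1 + (n.+1 + d + e)).-1 = (n + (n.+1 + d + e)))%N by lia.
have -> : ((n + (n.+1 + d + e.+1)).-1 = (n + (n.+1 + d + e)))%N by lia.
have -> : (n.+1 + d + e.+1 + j = (n + d + e + j).+2)%N by lia.
have -> : (n.+1 + d + e + j = (n + d + e + j).+1)%N by lia.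
rewrite /= !binS !natrD -(natr1 e) -(natr1 d); ring.
Qed.

(** The prefactors are all multiples of [b]. After Pascal's rule the terms in 'C(T, K+2) cancel, and
    what remains is the ratio of 'C(T, K+1) to 'C(T, K). *)
Lemma forest_coef_stepA n d e j : (j <= n.+1)%N ->
  forest_coef n.+1 d.+1 e j =
  forest_coef n.+1 d e j + forest_coef n d.+2 e j
  + (if j is i.+1 then forest_coef n d.+1 e.+1 i else 0).
Proof.
move=> le_jn.
set N := (n + d).+1; set K := (n + d + e + j)%N; set T := (n + N + e)%N.
set b : R := 'C(N.+1, j)%:R / N.+1%:R.
have N0 : N%:R != 0 :> R by rewrite pnatr_eq0.
have N1 : N.+1%:R != 0 :> R by rewrite pnatr_eq0.
have bE : 'C(N.+1, j)%:R = N.+1%:R * b by rewrite /b mulrC divfK.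
have bN : 'C(N, j)%:R = (N.+1%:R - j%:R) * b.
  apply: (mulfI N1); rewrite mulrCA -bE mulrC -natrB; last by rewrite /N; lia.
  by rewrite mulrC -!natrM mul_bin_down.
have c01 : (n.+1%:R - j%:R) * 'C(T, K)%:R = K.+1%:R * 'C(T, K.+1)%:R :> R.
  rewrite -natrB // -!natrM mul_bin_left; congr (_ * _)%:R.
  by rewrite /T /K /N; lia.
have -> : (if j is i.+1 then forest_coef n d.+1 e.+1 i else 0) =
  j%:R * b / N%:R * (d.+1%:R * 'C(T, K)%:R + e.+1%:R * 'C(T, K.+1)%:R).
  case: j @K @b {le_jn c01} bE bN => [|i] K b bE bN; first by rewrite !mul0r.
  have bi : 'C(N, i)%:R = i.+1%:R * b.
    by apply: (mulfI N1); rewrite mulrCA -bE -!natrM mul_bin_diag.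
  rewrite /forest_coef.
  have -> : (n + d.+1 = N)%N by rewrite /N; lia.
  have -> : ((n + (N + e.+1)).-1 = T)%N by rewrite /T; lia.
  have -> : (N + e.+1 + i = K.+1)%N by rewrite /N /K; lia.
  by rewrite bi.
rewrite /forest_coef.
have -> : (n.+1 + d.+1 = N.+1)%N by rewrite /N; lia.
have -> : (n + d.+2 = N.+1)%N by rewrite /N; lia.
have -> : (n.+1 + d = N)%N by rewrite /N; lia.
have -> : ((n.+1 + (N.+1 + e)).-1 = T.+1)%N by rewrite /T; lia.
have -> : ((n.+1 + (N + e)).-1 = T)%N by rewrite /T; lia.
have -> : ((n + (N.+1 + e)).-1 = T)%N by rewrite /T; lia.
have -> : (N.+1 + e + j = K.+2)%N by rewrite /N /K; lia.
have -> : (N + e + j = K.+1)%N by rewrite /N /K; lia.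
rewrite /= !binS !natrD bN bE.
have NE : N%:R = n%:R + d%:R + 1 :> R by rewrite /N -natr1 natrD.
have KE : K%:R = n%:R + d%:R + e%:R + j%:R :> R by rewrite /K !natrD.
move: c01 bE bN N0 N1; rewrite -natr1 -(natr1 N) -(natr1 K) => c01 _ _ N0 N1.
(* The difference of the two sides is exactly that of [c01]. *)
have NK : N%:R * ((d%:R + 1) * 'C(T, K)%:R + (e%:R - 1) * 'C(T, K.+1)%:R)
  = (N%:R + 1 - j%:R) * (d%:R * 'C(T, K)%:R + e%:R * 'C(T, K.+1)%:R)
    + j%:R * ((d%:R + 1) * 'C(T, K)%:R + (e%:R + 1) * 'C(T, K.+1)%:R) :> R.
  move/eqP: c01; rewrite NE KE -subr_eq0 => /eqP c01.
  by apply/subr0_eq; rewrite -c01; ring.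
apply/subr0_eq; move/eqP: NK; rewrite -subr_eq0 => /eqP NK.
rewrite -(mulr0 (b / N%:R)) -NK.
move: N0 N1; clearbody b N K T; move=> N0 N1.
by field; rewrite ?N0 ?N1.
Qed.
End ClosedForm.

(** * The recurrences for the counting polynomial *)

Section ForestCount.
Variable R : numFieldType.
Variables (p q : R).

Lemma forest_coef_gt n d e : (0 < n + d)%N -> forest_coef R n d e n.+1 = 0.
Proof.
move=> nd; rewrite /forest_coef (bin_small (m := (n + d + e + n.+1)%N.-1)); last by lia.
rewrite (bin_small (m := (n + d + e + n.+1)%N)); last by lia.
by rewrite !mulr0 addr0 mulr0.
Qed.

Definition forest_form n d e := binary_form p q (forest_coef R n d e) n.

(** For d = 0 the division by zero would give 0 instead of 1; this is why positivity of n + d is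
    assumed when counting forests. *)
Lemma forest_form0 d e : (0 < d)%N -> forest_form 0 d e = 1.
Proof.
move=> d0; rewrite /forest_form /binary_form big_ord1 /forest_coef bin0.
rewrite !add0n addn0 binn (bin_small (m := d + e)); last by lia.
by rewrite !expr0 mulr0 addr0 !mulr1 mul1r mulVf // pnatr_eq0 -lt0n.
Qed.

Lemma forest_form00 n : forest_form n 0 0 = 0.
Proof. by apply: big1 => j _; rewrite /forest_coef !mul0r addr0 mulr0 mul0r. Qed.

Lemma forest_formB n d e : forest_form n.+1 d e.+1 =
  forest_form n.+1 d e + p * forest_form n d.+1 e.+1.
Proof.
have c0 : forest_coef R n d.+1 e.+1 n.+1 = 0 by rewrite forest_coef_gt // addnS.
have := binary_form_step p q (fun=> 0) c0.
rewrite [X in q * X]big1 => [|i _]; last by rewrite mul0r.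
rewrite mulr0 addr0 => ->; rewrite -binary_formD; apply: eq_binary_form => j _.
by rewrite forest_coef_stepB; case: j => [|j]; rewrite addr0.
Qed.

Lemma forest_formA n d e : forest_form n.+1 d.+1 e =
  forest_form n.+1 d e + (p * forest_form n d.+2 e + q * forest_form n d.+1 e.+1).
Proof.
rewrite binary_form_step; last by rewrite forest_coef_gt // addnS.
rewrite -binary_formD; apply: eq_binary_form => j jn.
by rewrite forest_coef_stepA // addrA.
Qed.
End ForestCount.

(** * Counting forests and trees for two classes of labels *)

Section TwoClasses.
Variables (R : numFieldType) (L : finType) (A : pred L).
Let e : rel L := fun x y => A x || A y.
Let p : R := #|A|%:R.
Let q : R := #|predC A|%:R.

Lemma sum_classes (f : L -> R) (u v : R) :
  (forall x, f x = if A x then u else v) -> \sum_x f x = p * u + q * v.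
Proof.
move=> fE; rewrite (bigID A) /=.
rewrite (eq_bigr (fun=> u)); last by move=> x Ax; rewrite fE Ax.
rewrite [X in _ + X](eq_bigr (fun=> v)); last by move=> x /negPf Ax; rewrite fE Ax.
by rewrite !sumr_const !mulr_natl.
Qed.

Lemma size_rooted_forests n s : (0 < n + count A s)%N ->
  (size (rooted_forests e n s))%:R =
  forest_form p q n (count A s) (count (predC A) s).
Proof.
elim: n s => [|n IHn] s; first by rewrite add0n => s0; rewrite forest_form0.
(* Without roots there is no forest with a positive number of vertices. *)
elim: s => [_|y s IHs _]; first by rewrite /= forest_form00.
rewrite size_rooted_forestsS natrD IHs ?addSn // natr_sum /= /e.
(* A root in [A] accepts any child, another root only children in [A]. Either way the new list of
   roots meets [A], so the positivity condition persists. *)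
case Ay: (A y); rewrite /= ?add0n ?add1n.
  rewrite forest_formA; congr (_ + _).
  apply: sum_classes => x; rewrite IHn /= ?Ay; last by lia.
  by case: (A x); rewrite /= ?add0n ?add1n.
rewrite forest_formB; congr (_ + _).
rewrite (eq_bigr (fun=> forest_form p q n (count A s).+1 (count (predC A) s).+1)).
  by rewrite sumr_const mulr_natl.
by move=> x Ax; rewrite IHn /= Ax ?Ay ?add0n ?add1n //; lia.
Qed.

Definition tree_coef (k j : nat) : R :=
  2 * 'C(k.+1, j)%:R / k.+1%:R * 'C((2 * k).-1, (k + j).-1)%:R.

(** With b = 'C(k+1, j) / (k+1), roots in [A] contribute b 'C(2k, k+j) and the others j/k times as
    much; absorbing k + j into the binomial gives [tree_coef]. *)
Lemma sum_size_rooted_forests k : (0 < k)%N ->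
  (\sum_x size (rooted_forests e k [:: x]))%:R =
  binary_form p q (tree_coef k) k.+1.
Proof.
move=> k0; rewrite natr_sum.
rewrite (sum_classes (u := forest_form p q k 1 0) (v := forest_form p q k 0 1)).
  rewrite binary_form_step; last by rewrite forest_coef_gt // addn1.
  apply: eq_binary_form => j jk.
  have k0R : k%:R != 0 :> R by rewrite pnatr_eq0 -lt0n.
  have k1R : k.+1%:R != 0 :> R by rewrite pnatr_eq0.
  set b : R := 'C(k.+1, j)%:R / k.+1%:R.
  have -> : tree_coef k j = b / k%:R * ((k + j)%:R * 'C(2 * k, k + j)%:R).
    have -> : (k + j)%:R * 'C(2 * k, k + j)%:R
        = (2 * k%:R) * 'C((2 * k).-1, (k + j).-1)%:R :> R.
      rewrite -natrM -[2]/(2%:R) -!natrM; congr _%:R.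
      by have := mul_bin_diag (2 * k) (k + j).-1; rewrite prednK //; lia.
    by rewrite /tree_coef /b; field; rewrite k0R nat1r.
  rewrite [X in _ + X](_ : _ = b / k%:R * (j%:R * 'C(2 * k, k + j)%:R)); last first.
    case: j @b {jk} => [|i] b; first by rewrite mul0r mulr0.
    rewrite /forest_coef mul0r add0r mul1r addn0.
    have -> : ((k + (k + 1)).-1 = 2 * k)%N by lia.
    have -> : (k + 1 + i = k + i.+1)%N by lia.
    have -> : 'C(k, i)%:R = i.+1%:R * b.
      by apply: (mulfI k1R); rewrite [RHS]mulrCA [X in _ = _ * X]mulrC divfK // -!natrM mul_bin_diag.
    by field.
  rewrite /forest_coef mul0r addr0 mul1r addn0 addn1.
  have -> : ((k + k.+1).-1 = 2 * k)%N by lia.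
  have -> : ((k.+1 + j).-1 = k + j)%N by lia.
  by rewrite -/b natrD; field.
move=> x; rewrite size_rooted_forests /=; last by lia.
by case: (A x).
Qed.
End TwoClasses.

(** * The hypergeometric series *)

Section Hypergeometric.
Variables (R : realType) (k : nat).
Hypothesis k_gt0 : (0 < k)%N.

Lemma pochhammerS (a : R) j : pochhammer a j.+1 = pochhammer a j * (a + j%:R).
Proof. by rewrite /pochhammer big_ord_recr. Qed.

Lemma hypergeometric_termS (a b c x : R) j :
  hypergeometric_term a b c x j.+1 = hypergeometric_term a b c x j
    * ((a + j%:R) * (b + j%:R) / (c + j%:R) * (x / j.+1%:R)).
Proof.
rewrite /hypergeometric_term !pochhammerS exprS factS natrM !invfM.
ring.
Qed.

(** This is 'C(2k, k) = 2 'C(2k-1, k-1), by Pascal's rule and symmetry. *)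
Lemma catalanE : catalan R k = tree_coef R k 0.
Proof.
rewrite /catalan /tree_coef bin0 mulr1 addn0 [LHS]mulrC mulrAC; congr (_ / _).
case: k k_gt0 => // m _; rewrite -[2 in RHS]/(2%:R) -natrM; congr _%:R.
have -> : ((2 * m.+1).-1 = (2 * m).+1)%N by lia.
have -> : (2 * m.+1 = (2 * m).+2)%N by lia.
have eqC : 'C((2 * m).+1, m.+1) = 'C((2 * m).+1, m).
  by rewrite -bin_sub; last lia; congr 'C(_, _); lia.
by rewrite binS eqC /=; lia.
Qed.

(** Both sides have term ratio (k+1-j)(k-j) x / ((k+j)(j+1)); the two signs in the Pochhammer
    symbols cancel. *)
Lemma catalan_hypergeometric_term (x : R) j :
  catalan R k * hypergeometric_term (- k%:R - 1) (- k%:R) k%:R x j =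
  tree_coef R k j * x ^+ j.
Proof.
elim: j => [|j IHj].
  rewrite catalanE /hypergeometric_term /pochhammer !big_ord0.
  by rewrite expr0 fact0 !divr1 !mulr1.
rewrite hypergeometric_termS mulrA IHj exprS.
have kj : (k + j)%:R != 0 :> R by rewrite pnatr_eq0 -lt0n; lia.
have e1 : (k.+1%:R - j%:R) * 'C(k.+1, j)%:R = j.+1%:R * 'C(k.+1, j.+1)%:R :> R.
  have [jk|kj'] := leqP j k.+1; first by rewrite -natrB // -!natrM mul_bin_left.
  by rewrite !bin_small ?mulr0 //; lia.
have e2 : (k%:R - j%:R) * 'C((2 * k).-1, (k + j).-1)%:R
    = (k + j)%:R * 'C((2 * k).-1, k + j)%:R :> R.
  have [jk|kj'] := leqP j k; last by rewrite !bin_small ?mulr0 //; lia.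
  rewrite -natrB // -!natrM; congr _%:R.
  have := mul_bin_left (2 * k).-1 (k + j).-1; rewrite prednK; last by lia.
  by move=> ->; congr muln; lia.
have e3 : 'C(k.+1, j.+1)%:R = (k.+1%:R - j%:R) * 'C(k.+1, j)%:R / j.+1%:R :> R.
  by rewrite e1 mulrC mulKf // pnatr_eq0.
have e4 : 'C((2 * k).-1, k + j)%:R
    = (k%:R - j%:R) * 'C((2 * k).-1, (k + j).-1)%:R / (k + j)%:R :> R.
  by rewrite e2 mulrC mulKf.
rewrite /tree_coef addnS /= e3 e4.
have k1 : k.+1%:R != 0 :> R by rewrite pnatr_eq0.
have j1 : j.+1%:R != 0 :> R by rewrite pnatr_eq0.
move: kj k1 j1; rewrite natrD -!natr1 => kj k1 j1.
by field; rewrite kj k1 j1.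
Qed.

Lemma catalan_hyp2F1 (x : R) :
  catalan R k * hyp2F1 (- k%:R - 1) (- k%:R) k%:R x =
  \sum_(j < k.+2) tree_coef R k j * x ^+ j.
Proof.
have -> : hyp2F1 (- k%:R - 1) (- k%:R) k%:R x
    = \sum_(j < k.+2) hypergeometric_term (- k%:R - 1) (- k%:R) k%:R x j.
  (* The series terminates, so its partial sums are eventually constant. The bound [k.+2] keeps the
     vanishing term of index k + 1, to match a form of degree k + 1. *)
  apply: lim_near_cst => //; exists k.+2 => // n /= kn.
  rewrite seriesEnat /= -(big_mkord xpredT) (big_cat_nat (n := k.+2)) //=.
  rewrite [X in _ + X]big_nat_cond [X in _ + X]big1 ?addr0 // => j /andP[/andP[kj _] _].
  rewrite /hypergeometric_term /pochhammer.
  have jk : (k < j)%N by exact: ltnW.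
  (* The factor of index k in the Pochhammer symbol of -k is zero. *)
  rewrite [X in _ * X / _](bigD1 (Ordinal jk)) //= addNr.
  by rewrite mul0r mulr0 !mul0r.
by rewrite big_distrr; apply: eq_bigr => j _; exact: catalan_hypergeometric_term.
Qed.
End Hypergeometric.

(** * Specialization to the fat hook *)

Lemma diagram_rel_fat_hook a1 a2 (x y : 'I_(part_length (fat_hook a1 a2))) :
  (0 < a1)%N -> diagram_rel x y = (x < a1)%N || (y < a1)%N.
Proof.
move=> a1_gt0; have := ltn_ord x; have := ltn_ord y; rewrite /diagram_rel inE /=.
move: (nat_of_ord x) (nat_of_ord y) => i j; rewrite fat_hook_length //.
rewrite /fat_hook nth_cat !nth_nseq size_nseq => jl il.
by do !case: ifP; lia.
Qed.

Theorem corollary3p6 (R : realType) (a1 a2 : nat) (a1_gt0 : (0 < a1)%N)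
    (a2_gt0 : (0 < a2)%N) (k : nat) (k_ge1 : (1 <= k)%N) :
  (num_lambda_trees (fat_hook a1 a2) k.+1)%:R =
  catalan R k * a1%:R ^+ k.+1
  * hyp2F1 (- k%:R - 1) (- k%:R) k%:R (a2%:R / a1%:R) :> R.
Proof.
set l := part_length (fat_hook a1 a2).
have lE : l = (a1 + a2)%N by exact: fat_hook_length.
pose A : pred 'I_l := fun x => (x < a1)%N.
have cardA : #|A| = a1.
  have le_a1l : (a1 <= l)%N by rewrite lE leq_addr.
  by rewrite -sum1_card (big_ord_narrow le_a1l) sum1_card card_ord.
have cardB : #|predC A| = a2.
  by apply: (@addnI a1); rewrite -lE -[RHS]card_ord -{1}cardA cardC.
have eE : @diagram_rel (fat_hook a1 a2) = (fun x y => A x || A y).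
  by apply/funext => x; apply/funext => y; exact: diagram_rel_fat_hook.
have vP t : edgewise_tree (fun x y => A x || A y) k.+1 t =
    (t \in codom (@lambda_tree_val (fat_hook a1 a2) k.+1)).
  rewrite /edgewise_tree -eE; apply/idP/codomP => [tP|[[u uP] ->] //].
  by exists (LambdaTree (tP : is_lambda_tree k.+1 t)).
rewrite /num_lambda_trees (count_edgewise_trees val_inj vP).
rewrite sum_size_rooted_forests // cardA cardB mulrAC catalan_hyp2F1 //.
rewrite big_distrl; apply: eq_bigr => j _.
have a1n0 : a1%:R ^+ j != 0 :> R by rewrite expf_neq0 // pnatr_eq0 -lt0n.
rewrite -[RHS]mulrA; congr (_ * _).
(* The factor a1^j clears the denominator of (a2/a1)^j. *)
have -> : a1%:R ^+ k.+1 = a1%:R ^+ j * a1%:R ^+ (k.+1 - j) :> R.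
  by rewrite -exprD subnKC // -ltnS.
by rewrite expr_div_n mulrA divfK // mulrC.
Qed.
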